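(* Let $\mathcal A'$ be a hyperplane arrangement in $\mathbb K^3$, let $H\notin\mathcal A'$ be a linear plane in $\mathbb K^3$, and let $\mathcal A:=\mathcal A'\cup\{H\}$ (with $\mathcal A$ and $\mathcal A'$ essential). Assume that $r(\mathcal A)=r$. If $|\mathcal A^H|\ge r+2$, then $r(\mathcal A')=r-1$.
   Context: $\mathbb K$ is a field of characteristic zero, $S=\mathbb K[x_1,x_2,x_3]$ with the standard grading, and $\operatorname{Der} S=\bigoplus_{i=1}^3 S\,\partial_{x_i}$, where $\sum a_i\partial_{x_i}$ is homogeneous of degree $e$ if all $a_i\in S_e$. A hyperplane arrangement in $\mathbb K^3$ is a finite set of (distinct) linear planes of $\mathbb K^3$ (equivalently, a line arrangement in $\mathbb P^2$); it is essential if the planes intersect only in $0$. For each plane $H$ fix a linear form $\alpha_H$ with $\ker\alpha_H=H$, and let $Q(\mathcal A)=\prod_{H\in\mathcal A}\alpha_H$. Let $D_0(\mathcal A)=\{\theta\in\operatorname{Der}S\mid \theta(Q(\mathcal A))=0\}$ and $r(\mathcal A)=\min\{e\mid D_0(\mathcal A)_e\ne 0\}$. For $H\in\mathcal A$, $\mathcal A^H=\{H\cap L\mid L\in\mathcal A\setminus\{H\}\}$; thus $|\mathcal A^H|$ is the number of points of $\mathbb P(H)$ at which it meets the other lines of the arrangement. *)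

(* Defs.v *)
From mathcomp Require Import all_boot all_order all_algebra.
From mathcomp Require Export finmap.
From mathcomp Require Export mpoly.

Set Implicit Arguments.
Unset Strict Implicit.
Unset Printing Implicit Defensive.

Import GRing.Theory.
Local Open Scope fset_scope.
Local Open Scope ring_scope.

Section Arrangement.

Variable K : fieldType.

Definition space3 := 'rV[K]_3.

Definition is_plane (H : {vspace space3}) : Prop := \dim H = 2%N.

Definition is_arrangement (A : {fset {vspace space3}}) : Prop :=
  forall L, L \in A -> is_plane L.

Definition essential (A : {fset {vspace space3}}) : Prop :=
  (\bigcap_(L <- A) L)%VS = 0%VS.

(* The zero form is excluded when H is a plane, as its kernel is everything. *)
Definition is_form_of (H : {vspace space3}) (a : {mpoly K[3]}) : Prop :=
  a \is 1.-homog /\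
  forall v : space3, v \in H <-> a.@[fun i => v ord0 i] = 0.

Definition defining_poly (alpha : {vspace space3} -> {mpoly K[3]})
    (A : {fset {vspace space3}}) : {mpoly K[3]} :=
  \prod_(L <- A) alpha L.

(* The derivation sum_i a_i d/dx_i is encoded by its coefficients (a_i)_i. *)
Definition Der := {ffun 'I_3 -> {mpoly K[3]}}.

Definition der_apply (theta : Der) (p : {mpoly K[3]}) : {mpoly K[3]} :=
  \sum_(i < 3) theta i * p^`M(i).

Definition der_homog (e : nat) (theta : Der) : Prop :=
  forall i, theta i \is e.-homog.

(* Membership in the degree e component of D_0(A), where Q = Q(A). *)
Definition in_D0 (Q : {mpoly K[3]}) (e : nat) (theta : Der) : Prop :=
  der_homog e theta /\ der_apply theta Q = 0.

Definition D0_nonzero (Q : {mpoly K[3]}) (e : nat) : Prop :=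
  exists theta : Der, theta != 0 /\ in_D0 Q e theta.

(* r = min {e | D_0(A)_e <> 0}; a relation, since minima of undecided
   predicates on nat are not computable. *)
Definition is_r (alpha : {vspace space3} -> {mpoly K[3]})
    (A : {fset {vspace space3}}) (r : nat) : Prop :=
  D0_nonzero (defining_poly alpha A) r /\
  forall e, D0_nonzero (defining_poly alpha A) e -> (r <= e)%N.

Definition restriction (A : {fset {vspace space3}}) (H : {vspace space3}) :
    {fset {vspace space3}} :=
  [fset (H :&: L)%VS | L in A `\ H].

End Arrangement.

(* Main.v *)
Require Import Defs.
From mathcomp Require Import all_boot all_order all_algebra.
From mathcomp Require Import finmap mpoly ring.

Import GRing.Theory.
Local Open Scope fset_scope.
Local Open Scope ring_scope.

(** Write [a] for the form of [H], [q] for [Q(A')], so that [Q(A) = a * q], let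
    [E] be the Euler derivation and [n] the number of planes in [A'].

    Going up is elementary. If [phi] kills [q], then [a * phi] multiplies [a * q]
    by [phi(a)], and subtracting the multiple [phi(a) / (n + 1)] of [E] gives a
    nonzero derivation killing [a * q], of degree one more ([D0_addition]). Hence
    [r(A) <= r(A') + 1].

    For the other inequality let [theta] be a derivation of degree [r] killing
    [Q(A)]. It preserves the ideal of every plane of [A], since distinct linear
    forms are coprime ([D0_dvdm_form]). So it restricts to a derivation of the
    plane [H] that preserves each of the at least [r + 2] lines of the
    restriction. At a point of such a line the restricted vector field is
    proportional to the position vector; in coordinates [x, y] of [H], the minor
    [x * theta_y - y * theta_x] vanishes on each of these lines. As it has degree
    [r + 1], it is zero, so on [H] the derivation is a multiple [h * E] of the
    Euler derivation ([euler_mod_form]).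

    Consequently [theta - h * E] is divisible by [a]. Its quotient by [a] is only
    known to preserve the planes of [A'], but if [theta(a) = g * a], so that
    [theta(q) = - g * q], then evaluating [theta - h * E] on [q] shows that [a]
    divides [g + n * h]. Hence [a] also divides [theta + (g / n) * E], which kills
    [q], and the quotient is the required derivation of degree [r - 1]
    ([D0_deletion]).

    Congruences modulo a linear form [a] are made computable by the projection of
    the space onto the plane [a = 0] along a vector [c] with [a(c) = 1]: composing
    with it is a ring morphism whose kernel is the ideal of [a]
    ([dvdm_projectP]). Primality of linear forms follows at once. *)

(** * Divisibility by linear forms *)

Section LinearForms.

Local Set Implicit Arguments.
Local Unset Strict Implicit.

Variables (n : nat) (K : fieldType).
Implicit Types (p q w a b : {mpoly K[n]}) (v c : 'I_n -> K).

Definition dvdm d p : Prop := exists q : {mpoly K[n]}, p = q * d.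

Lemma dvdm_refl d : dvdm d d.
Proof. by exists 1; rewrite mul1r. Qed.

Lemma dvdm0 d : dvdm d 0.
Proof. by exists 0; rewrite mul0r. Qed.

Lemma dvdm_mull d p q : dvdm d q -> dvdm d (p * q).
Proof. by case=> u ->; exists (p * u); rewrite mulrA. Qed.

Lemma dvdm_mulr d p q : dvdm d p -> dvdm d (p * q).
Proof. by rewrite mulrC; apply: dvdm_mull. Qed.

Lemma dvdmD d p q : dvdm d p -> dvdm d q -> dvdm d (p + q).
Proof. by case=> u -> [v ->]; exists (u + v); rewrite mulrDl. Qed.

Lemma dvdmB d p q : dvdm d p -> dvdm d q -> dvdm d (p - q).
Proof. by case=> u -> [v ->]; exists (u - v); rewrite mulrBl. Qed.

Lemma dvdm_addl d p q : dvdm d q -> dvdm d (p + q) -> dvdm d p.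
Proof. by move=> dq dpq; rewrite -[p](addrK q); apply: dvdmB. Qed.

Lemma dvdmC d p (k : K) : k != 0 -> dvdm d (k%:MP * p) -> dvdm d p.
Proof.
move=> k0 [u E]; exists (k^-1%:MP * u).
by rewrite -mulrA -E mulrA -mpolyCM mulVf // mpolyC1 mul1r.
Qed.

Lemma dvdm_sum d (I : Type) (s : seq I) (F : I -> {mpoly K[n]}) :
  (forall i, dvdm d (F i)) -> dvdm d (\sum_(i <- s) F i).
Proof. by move=> dF; elim/big_ind: _ => //; [apply: dvdm0|apply: dvdmD]. Qed.

Lemma homog1E p : p \is 1.-homog -> p = \sum_i p@_U_(i) *: 'X_i.
Proof.
move=> hp; apply/mpolyP=> m; rewrite linear_sum /=.
case: (mdeg m =P 1%N) => [/eqP/mdeg1P[k /eqP->]|/eqP dm].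
  rewrite (bigD1 k) //= big1 ?addr0 ?mcoeffZ ?mcoeffX ?eqxx ?mulr1 // => i ik.
  by rewrite mcoeffZ mcoeffX eq_mnm1 (negPf ik) mulr0.
rewrite (dhomog_nemf_coeff hp dm) big1 // => i _.
rewrite mcoeffZ mcoeffX; case: (_ =P m) dm => [<-|_ _]; last by rewrite mulr0.
by rewrite mdeg1 eqxx.
Qed.

Lemma homogX1 i : ('X_i : {mpoly K[n]}) \is 1.-homog.
Proof. by rewrite dhomogX /= mdeg1. Qed.

Lemma homog_coef_neq0 p : p \is 1.-homog -> p != 0 -> exists i, p@_U_(i) != 0.
Proof.
move=> /homog1E pE p0; apply/existsP; apply: contraNT p0.
rewrite negb_exists => /forallP z; rewrite pE big1 // => i _.
by move: (z i); rewrite negbK => /eqP->; rewrite scale0r.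
Qed.

Lemma dhomog_msize_le d p : p \is d.-homog -> (msize p <= d.+1)%N.
Proof.
move=> hp; have [->|p0] := eqVneq p 0; first by rewrite msize0.
by rewrite -mlead_deg // ltnS (dhomog_mf hp) ?mlead_supp.
Qed.

Lemma msize_homog1 p : p \is 1.-homog -> p != 0 -> msize p = 2%N.
Proof.
by move=> hp p0; rewrite -mlead_deg // (dhomog_mf hp) ?mlead_supp.
Qed.

Section Cofactor.

Variable a : {mpoly K[n]}.
Hypotheses (ha : a \is 1.-homog) (a0 : a != 0).

Lemma cofactor_homog0 q : q * a \is 0.-homog -> q = 0.
Proof.
move=> /dhomog_msize_le; have [//|q0] := eqVneq q 0.
rewrite msizeM // (msize_homog1 ha a0) addn2 /= ltnS leqn0 msize_poly_eq0.
by rewrite (negPf q0).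
Qed.

(** Multiplication by [a] shifts the graded pieces by one, so the part of [q]
    outside degree [d] multiplies [a] into degrees other than [d.+1]. *)
Lemma cofactor_homog d q : q * a \is d.+1.-homog -> q \is d.-homog.
Proof.
move=> hqa; pose q' := q - pihomog mdeg d q.
have hq' : q' * a \is d.+1.-homog.
  by rewrite mulrBl rpredB // -[d.+1]addn1 dhomogM // pihomogP.
suff /eqP : q' * a = 0.
  rewrite mulf_eq0 (negPf a0) orbF subr_eq0 => /eqP->; exact: pihomogP.
rewrite -(pihomog_dE hq').
have pd k : pihomog mdeg d.+1 (pihomog mdeg k q * a)
    = if k == d then pihomog mdeg d q * a else 0.
  have hk : pihomog mdeg k q * a \is k.+1.-homog.
    by rewrite -[k.+1]addn1 dhomogM // pihomogP.
  case: eqP hk => [-> hk|/eqP kd hk]; first by rewrite pihomog_dE.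
  by rewrite (pihomog_ne0 _ hk).
(* The bound [msize q + d.+1] makes [d] one of the summation indices. *)
have qE := pihomog_partitionE (leq_addr d.+1 (msize q)).
rewrite mulrBl pihomogB pd eqxx {1}qE mulr_suml linear_sum /=.
have dlt : (d < msize q + d.+1)%N by rewrite addnS ltnS leq_addl.
rewrite (bigD1 (Ordinal dlt)) //= pd eqxx big1 ?addr0 ?subrr // => i ne.
rewrite pd; case: eqP => // e; case/eqP: ne; exact: val_inj.
Qed.

End Cofactor.

(** When [a.@[c] = 1], this is composition with the linear projection
    [x |-> x - a(x) c] onto the plane [a = 0], along the vector [c]. *)
Definition project a c p : {mpoly K[n]} :=
  p \mPo [tuple 'X_i - c i *: a | i < n].

Lemma project_X a c i : project a c 'X_i = 'X_i - c i *: a.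
Proof. by rewrite /project comp_mpolyXU -tnth_nth tnth_mktuple. Qed.

Lemma projectM a c : {morph project a c : p q / p * q}.
Proof. by move=> p q; rewrite /project rmorphM. Qed.

Lemma project_sum a c (I : Type) (s : seq I) (F : I -> {mpoly K[n]}) :
  project a c (\sum_(i <- s) F i) = \sum_(i <- s) project a c (F i).
Proof. exact: raddf_sum. Qed.

Lemma projectZ a c k p : project a c (k *: p) = k *: project a c p.
Proof. exact: comp_mpolyZ. Qed.

Lemma project_cong_mul a c p q : dvdm a (p - project a c p) ->
  dvdm a (q - project a c q) -> dvdm a (p * q - project a c (p * q)).
Proof.
move=> dp dq; rewrite projectM.
have -> : p * q - project a c p * project a c q
  = (p - project a c p) * q + project a c p * (q - project a c q).
  by rewrite mulrBl mulrBr addrA subrK.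
by apply: dvdmD; [apply: dvdm_mulr|apply: dvdm_mull].
Qed.

(** The projection moves each variable by a multiple of [a], and congruence modulo
    [a] is compatible with the ring operations. *)
Lemma project_cong a c p : dvdm a (p - project a c p).
Proof.
have d1 : dvdm a (1 - project a c 1).
  by rewrite /project comp_mpoly1 subrr; apply: dvdm0.
have dX i : dvdm a ('X_i - project a c 'X_i).
  rewrite project_X opprB addrC subrK -mul_mpolyC.
  exact/dvdm_mull/dvdm_refl.
rewrite [X in X - _]mpolyE [X in project _ _ X]mpolyE project_sum -sumrB.
apply: dvdm_sum => m; rewrite projectZ -scalerBr -mul_mpolyC.
apply: dvdm_mull; rewrite mpolyXE_id; elim/big_rec: _ => // i q _ dq.
apply: (@project_cong_mul a c _ q _ dq).
elim: (m i) => [|k IH]; first by rewrite expr0.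
by rewrite exprS; apply: (@project_cong_mul a c 'X_i _ (dX i) IH).
Qed.

Lemma project_homog a c d p : a \is 1.-homog -> p \is d.-homog ->
  project a c p \is d.-homog.
Proof.
move=> ha hp; rewrite /project comp_mpolyEX big_seq; apply: rpred_sum => m mp.
apply: rpredZ; rewrite comp_mpolyX -(dhomog_mf hp mp) /= mdegE.
elim/big_rec2: _ => [|i u e _ he]; first exact: dhomog1.
apply: dhomogM => //; rewrite -[X in X.-homog]mul1n; apply: dhomogMn.
by rewrite tnth_mktuple rpredB ?rpredZ ?homogX1.
Qed.

Lemma project_self a c : a \is 1.-homog -> a.@[c] = 1 -> project a c a = 0.
Proof.
move=> /homog1E aE ac; rewrite {2}aE project_sum.
under eq_bigr do rewrite projectZ project_X scalerBr scalerA.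
rewrite sumrB -aE -scaler_suml -[X in X - _]scale1r -scalerBl.
rewrite -ac {1}aE (raddf_sum (meval c)) /=.
under eq_bigr do rewrite mevalZ mevalXU.
by rewrite subrr scale0r.
Qed.

Lemma dvdm_projectP a c p : a \is 1.-homog -> a.@[c] = 1 ->
  dvdm a p <-> project a c p = 0.
Proof.
move=> ha ac; split=> [[q ->]|p0]; first by rewrite projectM project_self ?mulr0.
by rewrite -[p]subr0 -p0; apply: project_cong.
Qed.

Lemma coef_form_eval a i (k : K) : a \is 1.-homog ->
  a.@[fun j => if j == i then k else 0] = a@_U_(i) * k.
Proof.
move=> /homog1E aE; rewrite {1}aE (raddf_sum (meval _)) /= (bigD1 i) //=.
rewrite mevalZ mevalXU eqxx big1 ?addr0 // => j ji.
by rewrite mevalZ mevalXU (negPf ji) mulr0.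
Qed.

(** The ideal of [a] is the kernel of a ring morphism into a domain, namely of the
    projection along a multiple of a basis vector on which [a] does not vanish. *)
Lemma form_prime a p q : a \is 1.-homog -> a != 0 ->
  dvdm a (p * q) -> dvdm a p \/ dvdm a q.
Proof.
move=> ha /(homog_coef_neq0 ha)[i ai].
have := coef_form_eval i (a@_U_(i))^-1 ha; rewrite mulfV // => ac.
rewrite !(dvdm_projectP _ ha ac) projectM => /eqP.
by rewrite mulf_eq0 => /orP[]/eqP; [left|right].
Qed.

Lemma form_prime_prod a (I : eqType) (s : seq I) (F : I -> {mpoly K[n]}) :
  a \is 1.-homog -> a != 0 -> dvdm a (\prod_(i <- s) F i) ->
  exists2 i, i \in s & dvdm a (F i).
Proof.
move=> ha a0; elim: s => [|i s IH].
  rewrite big_nil => -[q /esym qa]; have := cofactor_homog0 ha a0 (q := q).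
  rewrite qa dhomog1 => /(_ isT) q0; move/eqP: qa.
  by rewrite q0 mul0r eq_sym oner_eq0.
rewrite big_cons => /(form_prime ha a0)[ai|/IH[j js aj]].
  by exists i; rewrite ?mem_head.
by exists j; rewrite // inE js orbT.
Qed.

Lemma prod_forms_dvdm (I : eqType) (s : seq I) (F : I -> {mpoly K[n]}) w :
  uniq s ->
  (forall i, i \in s -> [/\ F i \is 1.-homog, F i != 0 & dvdm (F i) w]) ->
  (forall i j, i \in s -> j \in s -> i != j -> ~ dvdm (F i) (F j)) ->
  dvdm (\prod_(i <- s) F i) w.
Proof.
elim: s => [|i s IH] /=; first by exists w; rewrite big_nil mulr1.
case/andP=> is_ us hF nF; rewrite big_cons.
have [||q E] := IH us.
- by move=> j js; apply: hF; rewrite inE js orbT.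
- by move=> j k js ks; apply: nF; rewrite inE ?js ?ks orbT.
have [hi i0 [u wE]] := hF i (mem_head _ _).
have iq : dvdm (F i) (q * \prod_(j <- s) F j) by exists u; rewrite -E.
have [[v qE]|/(form_prime_prod hi i0)[j js ij]] := form_prime hi i0 iq.
  by exists v; rewrite E qE mulrA.
case: (nF i j (mem_head _ _) _ _ ij); first by rewrite inE js orbT.
by apply: contraNneq is_ => ->.
Qed.

Lemma msize_prod_forms (I : eqType) (s : seq I) (F : I -> {mpoly K[n]}) :
  (forall i, i \in s -> F i \is 1.-homog /\ F i != 0) ->
  msize (\prod_(i <- s) F i) = (size s).+1.
Proof.
elim: s => [|i s IH] hF; first by rewrite big_nil msize1.
have [hi i0] := hF i (mem_head _ _).
have sE : msize (\prod_(j <- s) F j) = (size s).+1.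
  by apply: IH => j js; apply: hF; rewrite inE js orbT.
rewrite big_cons msizeM //; last by rewrite -msize_poly_eq0 sE.
by rewrite sE (msize_homog1 hi i0).
Qed.

(** Pairwise coprime linear forms dividing [w] have a product dividing [w], and this
    product has more than the degree of [w] as its degree. *)
Lemma too_many_forms (I : eqType) (s : seq I) (F : I -> {mpoly K[n]}) w :
  uniq s ->
  (forall i, i \in s -> [/\ F i \is 1.-homog, F i != 0 & dvdm (F i) w]) ->
  (forall i j, i \in s -> j \in s -> i != j -> ~ dvdm (F i) (F j)) ->
  (msize w <= size s)%N -> w = 0.
Proof.
move=> us hF nF; have [//|w0] := eqVneq w 0.
have [q wE] := prod_forms_dvdm us hF nF.
have pE : msize (\prod_(i <- s) F i) = (size s).+1.
  by apply: msize_prod_forms => i /hF[].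
have p0 : \prod_(i <- s) F i != 0 by rewrite -msize_poly_eq0 pE.
have q0 : q != 0 by apply: contraNneq w0 => q0; rewrite wE q0 mul0r.
rewrite wE msizeM // pE addnS /= => le; move: q0.
rewrite -msize_poly_eq0; case: (msize q) le => // m.
by rewrite addSn ltnNge leq_addl.
Qed.

End LinearForms.

(** * Derivations preserving linear forms *)

Section Derivations.

Local Set Implicit Arguments.
Local Unset Strict Implicit.

Variable K : fieldType.
Implicit Types (p q w a b h : {mpoly K[3]}) (theta : Der K).

Lemma derM theta p q :
  der_apply theta (p * q) = der_apply theta p * q + p * der_apply theta q.
Proof.
rewrite /der_apply mulr_suml mulr_sumr -big_split /=; apply: eq_bigr => i _.
by rewrite mderivM; ring.
Qed.

Lemma der_form theta a : a \is 1.-homog ->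
  der_apply theta a = \sum_i a@_U_(i) *: theta i.
Proof.
move=> /homog1E aE; apply: eq_bigr => i _; rewrite -mul_mpolyC mulrC.
congr (_ * _).
have UU : (U_(i) - U_(i))%MM = 0%MM :> 'X_{1..3}.
  by apply/mnmP => j; rewrite mnmBE subnn mnm0E.
rewrite [in LHS]aE linear_sum /= (bigD1 i) //= big1 ?addr0.
  by rewrite mderivZ mderivX mnm1E eqxx UU mpolyX0 scale1r alg_mpolyC.
move=> j ji; rewrite mderivZ mderivX mnm1E (negPf ji).
by rewrite scale0r scaler0.
Qed.

Lemma der_comb theta (eta : Der K) (f g : {mpoly K[3]}) p :
  der_apply [ffun i => f * theta i + g * eta i] p
  = f * der_apply theta p + g * der_apply eta p.
Proof.
rewrite /der_apply !mulr_sumr -big_split; apply: eq_bigr => i _ /=.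
by rewrite ffunE; ring.
Qed.

Definition euler : Der K := [ffun i => 'X_i].

Lemma euler_form a : a \is 1.-homog -> der_apply euler a = a.
Proof.
move=> ha; rewrite der_form // [RHS]homog1E //.
by apply: eq_bigr => i _; rewrite ffunE.
Qed.

Lemma euler_prod (I : eqType) (s : seq I) (F : I -> {mpoly K[3]}) :
  (forall i, i \in s -> F i \is 1.-homog) ->
  der_apply euler (\prod_(i <- s) F i) = (size s)%:R * \prod_(i <- s) F i.
Proof.
elim: s => [|i s IH] hF.
  rewrite big_nil mul0r /der_apply big1 // => i _.
  by rewrite -mpolyC1 mderivC mulr0.
rewrite big_cons derM euler_form ?hF ?mem_head // IH /=; last first.
  by move=> j js; apply: hF; rewrite inE js orbT.
by rewrite -(natr1 (size s)); ring.
Qed.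

Lemma other_indices (i : 'I_3) : exists j k : 'I_3, uniq [:: i; j; k].
Proof.
have [[lt0 lt1] lt2] : (0 < 3 /\ 1 < 3)%N /\ (2 < 3)%N by [].
case: i => [[|[|[|//]]] lti].
- by exists (Ordinal lt1), (Ordinal lt2).
- by exists (Ordinal lt0), (Ordinal lt2).
by exists (Ordinal lt0), (Ordinal lt1).
Qed.

Lemma perm_indices (i j k : 'I_3) :
  uniq [:: i; j; k] -> perm_eq (index_enum 'I_3) [:: i; j; k].
Proof.
move=> u; rewrite perm_sym; apply: uniq_perm; rewrite ?index_enum_uniq //.
have sub : {subset [:: i; j; k] <= enum 'I_3} by move=> l; rewrite mem_enum.
have [|_ eq] := uniq_min_size u sub; first by rewrite size_enum_ord.
by move=> l; rewrite eq mem_enum mem_index_enum.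
Qed.

Lemma sum_indices (i j k : 'I_3) (F : 'I_3 -> {mpoly K[3]}) :
  uniq [:: i; j; k] -> \sum_l F l = F i + F j + F k.
Proof.
move=> /perm_indices/(perm_big _) ->.
by rewrite !big_cons big_nil /= addr0 addrA.
Qed.

(** Eliminating [xi] and [ti] with the first two relations leaves the form and the
    derivation in the variables [xj], [xk]; there the position [(xj, xk)] and the
    vector [(tj, tk)] satisfy the same linear equation modulo [b], so their minor
    vanishes modulo [b] once a coefficient of this equation is inverted. *)
Lemma minor_eliminate (R S : comPzRingType) (f : {rmorphism R -> S})
    (ai aj ak bi bj bk : R) (xi xj xk ti tj tk b u : S) :
  f ai * xi + f aj * xj + f ak * xk = 0 ->
  f ai * ti + f aj * tj + f ak * tk = 0 ->
  f bi * xi + f bj * xj + f bk * xk = b ->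
  f bi * ti + f bj * tj + f bk * tk = u * b ->
  [/\ f (ai * bj - bi * aj) * (xj * tk - xk * tj) = f ai * (tk - xk * u) * b,
      f (ai * bk - bi * ak) * (xj * tk - xk * tj) = f ai * (xj * u - tj) * b
    & f (ai * bj - bi * aj) * xj + f (ai * bk - bi * ak) * xk = f ai * b].
Proof.
move=> ax at_ bx bt; rewrite !rmorphB !rmorphM; split.
- transitivity (f ai * tk * b - f ai * xk * (u * b) - f bi * tk * 0
                + f bi * xk * 0); last by ring.
  by rewrite -{1}ax -at_ -bt -bx; ring.
- transitivity (f ai * xj * (u * b) - f ai * tj * b + f bi * tj * 0
                - f bi * xj * 0); last by ring.
  by rewrite -{1}ax -at_ -bt -bx; ring.
transitivity (f ai * b - f bi * 0); last by ring.
by rewrite -ax -bx; ring.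
Qed.

(** The projection fixes the variables of index [j] and [k], which serve as coordinates
    on the plane [a = 0]; [project a c b] is the trace of [b] on that plane. A vector
    field tangent to this trace is proportional to the position vector along it,
    because both lie in the line that is its zero set. *)
Lemma dvdm_minor a b theta (c : 'I_3 -> K) (i j k : 'I_3) :
  a \is 1.-homog -> b \is 1.-homog -> a.@[c] = 1 ->
  a@_U_(i) != 0 -> c j = 0 -> c k = 0 ->
  uniq [:: i; j; k] -> project a c b != 0 ->
  dvdm a (der_apply theta a) -> dvdm b (der_apply theta b) ->
  dvdm (project a c b)
    ('X_j * project a c (theta k) - 'X_k * project a c (theta j)).
Proof.
move=> ha hb ac ai cj ck uijk b0 /(dvdm_projectP _ ha ac) + [u].
have lin (p : {mpoly K[3]}) (f : 'I_3 -> {mpoly K[3]}) :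
    \sum_l p@_U_(l) *: f l
  = (p@_U_(i))%:MP * f i + (p@_U_(j))%:MP * f j + (p@_U_(k))%:MP * f k.
  by rewrite (sum_indices _ uijk) -!mul_mpolyC.
have XE l : c l = 0 -> project a c 'X_l = 'X_l.
  by move=> cl; rewrite project_X cl scale0r subr0.
have projlin p (f : 'I_3 -> {mpoly K[3]}) :
    project a c (\sum_l p@_U_(l) *: f l)
  = \sum_l p@_U_(l) *: project a c (f l).
  by rewrite project_sum; apply: eq_bigr => l _; rewrite projectZ.
have projform p : p \is 1.-homog ->
    project a c p = \sum_l p@_U_(l) *: project a c 'X_l.
  by move=> hp; rewrite {1}(homog1E hp) projlin.
rewrite !der_form // => Ea /(congr1 (project a c)).
rewrite projectM projlin lin => Eb; rewrite projlin lin in Ea.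
have Xa := project_self ha ac.
rewrite (projform _ ha) lin !(XE j, XE k) // in Xa.
have Xb := projform _ hb; rewrite lin !(XE j, XE k) // in Xb.
have [] := minor_eliminate (f := @mpolyC 3 K) Xa Ea (esym Xb) Eb.
set Bj := _ * b@_U_(j) - _; set Bk := _ * b@_U_(k) - _ => wj wk wb.
(* [Bj] and [Bk] are the coefficients of the trace of [b] up to the factor
   [a@_U_(i)], so they do not both vanish. *)
have [Bj0|nBj] := eqVneq Bj 0; last by apply: (dvdmC nBj); eexists; exact: wj.
have [Bk0|nBk] := eqVneq Bk 0; last by apply: (dvdmC nBk); eexists; exact: wk.
move: wb b0; rewrite Bj0 Bk0 rmorph0 !mul0r addr0 => /esym/eqP.
by rewrite mulf_eq0 mpolyC_eq0 (negPf ai) => /= ->.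
Qed.

(** The separation hypothesis says that the forms [F l] have pairwise distinct
    traces on the plane [a = 0]. By [dvdm_minor] these at least [r + 2] traces all
    divide a minor of degree [r + 1], which is therefore zero. *)
Lemma euler_mod_form (I : eqType) (s : seq I) (F : I -> {mpoly K[3]})
    a theta (r : nat) :
  a \is 1.-homog -> a != 0 -> der_homog r theta ->
  dvdm a (der_apply theta a) -> uniq s -> (r + 2 <= size s)%N ->
  (forall l, l \in s ->
     F l \is 1.-homog /\ dvdm (F l) (der_apply theta (F l))) ->
  (forall l m, l \in s -> m \in s -> l != m ->
     exists v : 'I_3 -> K, [/\ a.@[v] = 0, (F l).@[v] = 0 & (F m).@[v] != 0]) ->
  exists h, forall i, dvdm a (theta i - h * 'X_i).
Proof.
move=> ha a0 hth da us ss hF sep.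
have [i ai] := homog_coef_neq0 ha a0.
pose c l := if l == i then (a@_U_(i))^-1 else 0.
have ac : a.@[c] = 1 by rewrite coef_form_eval // mulfV.
have [j [k uijk]] := other_indices i.
have /and3P[+ jk _] := uijk; rewrite !inE negb_or eq_sym => /andP[ji].
rewrite eq_sym => ki; rewrite inE in jk.
have cj : c j = 0 by rewrite /c (negPf ji).
have ck : c k = 0 by rewrite /c (negPf ki).
pose P := project a c.
have Peval p v : a.@[v] = 0 -> (P p).@[v] = p.@[v].
  move=> av; have [q E] := project_cong a c p.
  by rewrite -[in RHS](subrK (P p) p) E mevalD mevalM av mulr0 add0r.
have nPF l m : l \in s -> m \in s -> l != m -> ~ dvdm (P (F l)) (P (F m)).
  move=> ls ms lm [q E]; have [v [av Flv]] := sep l m ls ms lm.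
  by rewrite -(Peval _ _ av) E mevalM Peval // Flv mulr0 eqxx.
(* A second trace exists as [s] has at least two elements, and it is not
   contained in the zero set of [P (F l)]. *)
have PF0 l : l \in s -> P (F l) != 0.
  move=> ls; have [m ms ml] : exists2 m, m \in s & m != l.
    apply/hasP; apply: contraTT ss => /hasPn sl; rewrite -ltnNge.
    have /(uniq_leq_size us) : {subset s <= [:: l]}.
      by move=> m /sl; rewrite negbK inE.
    by rewrite addn2 => /leq_trans; apply.
  have [v [av _]] := sep m l ms ls ml; apply: contraNneq => z.
  by rewrite -(Peval _ _ av) z meval0.
have w0 : 'X_j * P (theta k) - 'X_k * P (theta j) = 0.
  apply: (too_many_forms (s := s) (F := fun l => P (F l))) => //.
    move=> l ls; have [hl dl] := hF l ls; split; first exact: project_homog.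
      exact: PF0.
    by apply: (dvdm_minor ha hl ac ai) => //; apply: PF0.
  apply: leq_trans ss; rewrite addn2; apply: (@dhomog_msize_le _ _ (1 + r)).
  by rewrite rpredB // dhomogM ?homogX1 ?project_homog.
have X0 l : 'X_l != 0 :> {mpoly K[3]}.
  by rewrite -msize_poly_eq0 msizeX.
(* From [x_j t_k = x_k t_j], coprimality of [x_j] and [x_k] gives [t_j = h x_j]. *)
have [h hj] : dvdm 'X_j (P (theta j)).
  have [||//] := form_prime (p := 'X_k) (q := P (theta j)) (homogX1 K j) (X0 j).
    exists (P (theta k)); apply/eqP; rewrite -subr_eq0 -oppr_eq0 opprB -w0.
    by rewrite mulrC.
  case=> q /(congr1 (fun p => p.@[fun l => if l == k then 1 else 0])).
  rewrite mevalM !mevalXU eqxx (negPf jk) mulr0 => /eqP.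
  by rewrite oner_eq0.
have hk : P (theta k) = h * 'X_k.
  apply: (mulfI (X0 j)); apply/eqP; rewrite -subr_eq0 -w0 hj; apply/eqP.
  by rewrite [h * _]mulrC mulrCA [h * _]mulrC.
exists h; pose D : Der K := [ffun l => 1 * theta l + (- h) * euler l].
have DE l : D l = theta l - h * 'X_l by rewrite !ffunE mul1r mulNr.
have dD l : P (theta l) = h * 'X_l -> dvdm a (D l).
  by rewrite DE => <-; apply: project_cong.
have dDa : dvdm a (der_apply D a).
  rewrite der_comb euler_form // mul1r; apply: dvdmD => //.
  exact/dvdm_mull/dvdm_refl.
(* The remaining coordinate is determined by the other two, because [D] preserves
   the ideal of [a] and the coefficient of [a] at [i] is invertible. *)
have Di : dvdm a (D i).
  apply: (dvdmC ai); move: dDa.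
  rewrite der_form // (sum_indices _ uijk) -!(mul_mpolyC _ (D _)).
  have dk : dvdm a ((a@_U_(k))%:MP * D k) by apply/dvdm_mull/dD.
  have dj : dvdm a ((a@_U_(j))%:MP * D j) by apply/dvdm_mull/dD.
  by move=> /(dvdm_addl dk)/(dvdm_addl dj).
move=> l; rewrite -DE.
have := mem_index_enum l; rewrite (perm_mem (perm_indices uijk)) !inE.
by case/or3P=> /eqP->; rewrite ?Di //; apply: dD.
Qed.

End Derivations.

(** * Multiplying by a linear form, and dividing it out *)

Section AdditionDeletion.

Local Set Implicit Arguments.
Local Unset Strict Implicit.

Variables (K : fieldType) (a q : {mpoly K[3]}) (n : nat).
Hypotheses (ha : a \is 1.-homog) (a0 : a != 0) (q0 : q != 0).
Hypotheses (euler_q : der_apply (euler K) q = (n%:R)%:MP * q).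
Hypotheses (n0 : n%:R != 0 :> K) (nS0 : n.+1%:R != 0 :> K).

Lemma euler_mul_form : der_apply (euler K) (a * q) = (n.+1%:R)%:MP * (a * q).
Proof.
by rewrite derM euler_form // euler_q -natr1 mpolyCD mpolyC1; ring.
Qed.

Lemma der_form_homog (e : nat) (theta : Der K) :
  der_homog e theta -> der_apply theta a \is e.-homog.
Proof.
move=> hth; rewrite der_form //; apply: rpred_sum => i _.
by apply: rpredZ; apply: hth.
Qed.

(** The derivation is [a * phi - (phi(a) / n.+1) * E]. If it is zero, then applying it
    to [q] gives [phi(a) = 0], hence [a * phi = 0]. *)
Lemma D0_addition (e : nat) : D0_nonzero q e -> D0_nonzero (a * q) e.+1.
Proof.
case=> phi [phi0 [hphi phiq]]; pose c := (n.+1%:R)^-1 : K.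
pose eta : Der K :=
  [ffun i => a * phi i + (- (c%:MP * der_apply phi a)) * euler K i].
have c0 : c != 0 by rewrite invr_eq0.
have cn : c%:MP * (n.+1%:R)%:MP = 1 :> {mpoly K[3]}.
  by rewrite -mpolyCM mulVf // mpolyC1.
exists eta; split.
  apply: contraNneq phi0 => etaE; apply/eqP/ffunP => i; rewrite ffunE.
  have : der_apply eta q = 0.
    by rewrite etaE /der_apply big1 // => j _; rewrite ffunE mul0r.
  rewrite der_comb phiq mulr0 add0r euler_q => /eqP.
  rewrite !(mulf_eq0, oppr_eq0, mpolyC_eq0) (negPf n0) (negPf q0) (negPf c0).
  rewrite /= orbF => /eqP phia.
  have /eqP : eta i = 0 by rewrite etaE ffunE.
  by rewrite ffunE phia mulr0 oppr0 mul0r addr0 mulf_eq0 (negPf a0) => /eqP.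
split=> [i|].
  rewrite !ffunE rpredD //; first by apply: (dhomogM (d := 1)).
  rewrite mulNr rpredN -mulrA mul_mpolyC rpredZ // -[e.+1]addn1.
  by rewrite dhomogM ?homogX1 ?der_form_homog.
rewrite der_comb derM phiq mulr0 addr0 euler_mul_form.
transitivity ((1 - c%:MP * (n.+1%:R)%:MP) * (a * (der_apply phi a * q))).
  by ring.
by rewrite cn subrr mul0r.
Qed.

(** With [theta(a) = g * a], the derivation is [(theta + (g / n) * E) / a]. That [a]
    divides the numerator comes from the congruence of [theta] with [h * E]:
    comparing the values on [q] gives [g + n * h = 0] modulo [a]. The
    quotient is nonzero: otherwise [theta] would be a multiple of [E], and the only
    multiple of [E] that kills [a * q] is zero. *)
Lemma D0_deletion (r : nat) (theta : Der K) h :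
  ~ dvdm a q -> theta != 0 -> in_D0 (a * q) r theta ->
  (forall i, dvdm a (theta i - h * 'X_i)) ->
  (0 < r)%N /\ D0_nonzero q (r - 1).
Proof.
move=> naq th0 [hth thaq] thh.
have thE : der_apply theta a * q + a * der_apply theta q = 0 by rewrite -derM.
have [g gE] : dvdm a (der_apply theta a).
  have : dvdm a (der_apply theta a * q).
    apply: (dvdm_addl (q := a * der_apply theta q)).
      exact/dvdm_mulr/dvdm_refl.
    by rewrite thE; apply: dvdm0.
  by case/(form_prime ha a0).
have thq : der_apply theta q = - (g * q).
  apply: (mulfI a0); apply/eqP; rewrite -subr_eq0 -thE gE; apply/eqP.
  by ring.
pose c := (n%:R)^-1 : K.
have cn : c%:MP * (n%:R)%:MP = 1 :> {mpoly K[3]}.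
  by rewrite -mpolyCM mulVf // mpolyC1.
have gh : dvdm a (g + (n%:R)%:MP * h).
  pose D : Der K := [ffun i => 1 * theta i + (- h) * euler K i].
  have dD : dvdm a (der_apply D q).
    apply: dvdm_sum => i; apply: dvdm_mulr.
    by rewrite !ffunE mul1r mulNr; apply: thh.
  have : dvdm a ((g + (n%:R)%:MP * h) * q).
    have -> : (g + (n%:R)%:MP * h) * q = (- 1) * der_apply D q.
      by rewrite der_comb thq euler_q; ring.
    exact: dvdm_mull.
  by case/(form_prime ha a0).
pose tau : Der K := [ffun i => 1 * theta i + (c%:MP * g) * euler K i].
have /fin_all_exists[f fE] : forall i, exists u, tau i = u * a.
  move=> i; rewrite -/(dvdm a (tau i)) !ffunE.
  have -> : 1 * theta i + c%:MP * g * 'X_i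
      = (theta i - h * 'X_i) + c%:MP * 'X_i * (g + (n%:R)%:MP * h).
    rewrite mulrDr mulrACA cn; ring.
  by apply: dvdmD; [apply: thh | apply: dvdm_mull].
pose phi : Der K := finfun f.
have tauE p : der_apply tau p = a * der_apply phi p.
  rewrite /der_apply mulr_sumr; apply: eq_bigr => i _.
  by rewrite fE ffunE mulrAC mulrC.
have phi0 : phi != 0.
  apply: contraNneq th0 => phiE; apply/eqP/ffunP => i; rewrite ffunE.
  have tau0 j : tau j = 0.
    by rewrite fE -[f j](ffunE f) -/phi phiE ffunE mul0r.
  have : der_apply tau (a * q) = 0.
    by rewrite /der_apply big1 // => j _; rewrite tau0 mul0r.
  rewrite der_comb thaq mulr0 add0r euler_mul_form => /eqP.
  rewrite !(mulf_eq0, mpolyC_eq0) (negPf nS0) (negPf q0) (negPf a0) invr_eq0.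
  rewrite (negPf n0) !orbF /= => /eqP g0.
  by have := tau0 i; rewrite ffunE g0 mulr0 mul0r addr0 mul1r.
have phiq : der_apply phi q = 0.
  apply: (mulfI a0); rewrite -tauE mulr0 der_comb thq euler_q.
  transitivity ((c%:MP * (n%:R)%:MP - 1) * (g * q)); first by ring.
  by rewrite cn subrr mul0r.
have hga : g * a \is r.-homog by rewrite -gE; apply: der_form_homog.
(* In degree 0 the form [a] cannot divide the numerator unless it vanishes, so
   [theta] would be zero. *)
case: r hth hga {thaq} => [|r] hth hga.
  have g0 := cofactor_homog0 ha a0 hga.
  case/negP: phi0; apply/eqP/ffunP => i; rewrite !ffunE.
  apply: (cofactor_homog0 ha a0); rewrite -fE ffunE g0 mulr0 mul0r addr0 mul1r.
  exact: hth.
split=> //; rewrite subn1; exists phi; split=> //; split=> // i.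
apply: (cofactor_homog ha a0); rewrite ffunE -fE !ffunE mul1r rpredD //.
  exact: hth.
rewrite -mulrA mul_mpolyC rpredZ // -[r.+1]addn1.
by apply: dhomogM (cofactor_homog ha a0 hga) (homogX1 K i).
Qed.

End AdditionDeletion.

(** * Planes, arrangements and the theorem *)

Section Planes.

Local Set Implicit Arguments.
Local Unset Strict Implicit.

Variable K : fieldType.
Implicit Types (H L M : {vspace (space3 K)}) (a b : {mpoly K[3]}).

Definition coords (v : space3 K) : 'I_3 -> K := fun i => v ord0 i.

Lemma plane_eq H L : is_plane H -> is_plane L -> (H <= L)%VS -> H = L.
Proof.
by move=> dH dL HL; apply/eqP; rewrite eqEdim HL dH dL.
Qed.

Lemma form_neq0 H a : is_plane H -> is_form_of H a -> a != 0.
Proof.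
move=> dH [_ aE]; apply: contra_eq_neq dH => a0.
suff -> : H = fullv by rewrite dimvf.
apply/vspaceP => v; rewrite memvf; apply/aE.
by rewrite a0 meval0.
Qed.

Lemma dvdm_forms_sub H L a b :
  is_form_of H a -> is_form_of L b -> dvdm a b -> (H <= L)%VS.
Proof.
move=> [_ aE] [_ bE] [q E]; apply/subvP => v /aE av.
by apply/bE; rewrite E mevalM av mulr0.
Qed.

Lemma dim_plane_cap H L :
  is_plane H -> is_plane L -> H != L -> \dim (H :&: L) = 1%N.
Proof.
move=> dH dL HL.
have lt2 : (\dim (H :&: L) < \dim H)%N.
  rewrite ltn_neqAle dimvS ?capvSl // andbT.
  apply: contra_neqN HL => /eqP e; apply: plane_eq => //.
  have /eqP <- : (H :&: L)%VS == H by rewrite eqEdim capvSl e leqnn.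
  exact: capvSr.
have le3 : (\dim (H + L) <= 3)%N.
  by apply: leq_trans (dimvS (subvf _)) _; rewrite dimvf.
have := dimv_sum_cap H L; rewrite dH in lt2 *; rewrite dL => e.
apply/eqP; rewrite eqn_leq -ltnS lt2 /= -(leq_add2l (\dim (H + L))) e.
by rewrite addn1.
Qed.

(** Both intersections are lines, so if distinct neither contains the other. *)
Lemma plane_cap_sep H L M :
  is_plane H -> is_plane L -> is_plane M -> H != L -> H != M ->
  (H :&: L)%VS != (H :&: M)%VS ->
  exists v, [/\ v \in H, v \in L & v \notin M].
Proof.
move=> dH dL dM HL HM ne.
have : ~~ (H :&: L <= M)%VS.
  apply: contraNN ne => sub; rewrite eqEdim subv_cap capvSl sub.
  by rewrite !dim_plane_cap.
by case/subvPn => v; rewrite memv_cap => /andP[vH vL] vM; exists v.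
Qed.

End Planes.

Section Arrangements.

Local Set Implicit Arguments.
Local Unset Strict Implicit.

Variable K : fieldType.
Implicit Types (H L : {vspace (space3 K)}) (A : {fset {vspace (space3 K)}}).
Implicit Type alpha : {vspace (space3 K)} -> {mpoly K[3]}.

Section FormsOf.

Variables (alpha : {vspace (space3 K)} -> {mpoly K[3]})
  (A : {fset {vspace (space3 K)}}).
Hypotheses (arrA : is_arrangement A)
  (formA : forall L, L \in A -> is_form_of L (alpha L)).

Lemma defining_poly_neq0 : defining_poly alpha A != 0.
Proof.
rewrite prodf_seq_neq0; apply/allP => L LA /=.
exact: form_neq0 (arrA LA) (formA LA).
Qed.

Lemma euler_defining_poly :
  der_apply (euler K) (defining_poly alpha A)
  = ((#|` A|%:R)%:MP) * defining_poly alpha A.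
Proof.
rewrite mpolyC_nat; apply: euler_prod => L LA.
by case: (formA LA).
Qed.

Lemma not_dvdm_defining_poly H a : is_plane H -> is_form_of H a ->
  H \notin A -> ~ dvdm a (defining_poly alpha A).
Proof.
move=> dH aH HA.
case/(form_prime_prod aH.1 (form_neq0 dH aH)) => L LA.
move/(dvdm_forms_sub aH (formA LA)).
by move/(plane_eq dH (arrA LA)) => E; rewrite E LA in HA.
Qed.

End FormsOf.

Lemma defining_polyU alpha A H : H \notin A ->
  defining_poly alpha (H |` A) = alpha H * defining_poly alpha A.
Proof. exact: big_fsetU1. Qed.

(** In [theta(a * q) = theta(a) * q + a * theta(q)], where [a] is the form of [L] and
    [q] the product of the others, [a] is prime and does not divide [q]. *)
Lemma D0_dvdm_form alpha A L (theta : Der K) :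
  is_arrangement A -> (forall M, M \in A -> is_form_of M (alpha M)) ->
  der_apply theta (defining_poly alpha A) = 0 -> L \in A ->
  dvdm (alpha L) (der_apply theta (alpha L)).
Proof.
move=> arrA formA + LA; rewrite -(fsetD1K LA).
set B := A `\ L; have LB : L \notin B by rewrite !inE eqxx.
have subA M : M \in B -> M \in A by rewrite inE => /andP[].
rewrite defining_polyU // derM => thE.
have /form_prime[||//|] : dvdm (alpha L)
    (der_apply theta (alpha L) * defining_poly alpha B).
- apply: (dvdm_addl (q := alpha L * der_apply theta (defining_poly alpha B))).
    exact/dvdm_mulr/dvdm_refl.
  by rewrite thE; apply: dvdm0.
- by case: (formA L LA).
- exact: form_neq0 (arrA L LA) (formA L LA).
have arrB : is_arrangement B by move=> M /subA; apply: arrA.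
have formB M (MB : M \in B) := formA M (subA M MB).
by move/(not_dvdm_defining_poly arrB formB (arrA L LA) (formA L LA) LB).
Qed.

End Arrangements.

Lemma map_uniq_inj (T U : eqType) (f : T -> U) (s : seq T) (x y : T) :
  uniq [seq f z | z <- s] -> x \in s -> y \in s -> f x = f y -> x = y.
Proof.
elim: s => //= z s IH /andP[fzs us]; rewrite !inE.
case/orP=> [/eqP->|xs] /orP[/eqP->|ys] // E; last exact: IH.
  by case/negP: fzs; rewrite E map_f.
by case/negP: fzs; rewrite -E map_f.
Qed.

Theorem theorem3p4 (K : fieldType) (charK0 : [pchar K] =i pred0)
    (A' : {fset {vspace (space3 K)}}) (H : {vspace (space3 K)})
    (alpha : {vspace (space3 K)} -> {mpoly K[3]}) (r : nat) :
  let A := H |` A' in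
  is_arrangement A' -> is_plane H -> H \notin A' ->
  essential A -> essential A' ->
  (forall L, L \in A -> is_form_of L (alpha L)) ->
  is_r alpha A r ->
  (r + 2 <= #|` restriction A H|)%N ->
  (0 < r)%N /\ is_r alpha A' (r - 1)%N.
Proof.
move=> A arrA' dH HA' _ essA' formA [[theta [th0 thA]] minr] cardH.
have A'A L : L \in A' -> L \in A by rewrite !inE orbC => ->.
have HA : H \in A by rewrite !inE eqxx.
have arrA : is_arrangement A.
  by move=> L; rewrite !inE => /orP[/eqP->|/arrA'].
have formA' L (LA : L \in A') := formA L (A'A L LA).
have [hH aH] := formA H HA; have a0 := form_neq0 dH (formA H HA).
have natK m : m.+1%:R != 0 :> K by rewrite (pcharf0P K).1.
(* An essential arrangement is not empty. *)
have n0 : #|` A'|%:R != 0 :> K.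
  rewrite (pcharf0P K).1 //; apply: contra_eqN essA' => /eqP/cardfs0_eq ->.
  by rewrite big_seq_fset0 -dimv_eq0 dimvf.
have q0 := defining_poly_neq0 arrA' formA'.
have Eq := euler_defining_poly formA'.
have lower e : D0_nonzero (defining_poly alpha A') e -> (r <= e.+1)%N.
  move=> /(D0_addition hH a0 q0 Eq n0 (natK _)).
  by rewrite -defining_polyU //; apply: minr.
(* One plane of [A'] for each element of the restriction. *)
have [s sub_s sE] : exists2 s, all (mem A') s &
    restriction A H = [seq (H :&: L)%VS | L <- s] :> seq _.
  apply/subset_mapP => X /imfsetP[L /= LA ->]; apply: map_f.
  by case/fsetD1P: LA => /eqP LH /fset1UP[].
have sA' L : L \in s -> L \in A' by apply: allP.
have umap : uniq [seq (H :&: L)%VS | L <- s] by rewrite -sE fset_uniq.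
have [h thh] : exists h, forall i, dvdm (alpha H) (theta i - h * 'X_i).
  have dvd L LA := D0_dvdm_form arrA formA thA.2 (L := L) LA.
  apply: (euler_mod_form (s := s) (F := alpha) hH a0 thA.1 (dvd H HA)).
  - exact: map_uniq umap.
  - by rewrite -(size_map (fun L => (H :&: L)%VS)) -sE.
  - move=> L /sA'/A'A LA; split; last exact: dvd.
    by case: (formA L LA).
  move=> L M Ls Ms LM.
  have HN N : N \in s -> H != N.
    by move=> /sA' NA; apply: contraNneq HA' => ->.
  have capLM : (H :&: L)%VS != (H :&: M)%VS.
    by apply: contraNneq LM => E; apply/eqP; exact: map_uniq_inj umap Ls Ms E.
  have [v [vH vL vM]] := plane_cap_sep dH (arrA' _ (sA' _ Ls))
    (arrA' _ (sA' _ Ms)) (HN _ Ls) (HN _ Ms) capLM.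
  exists (coords v); split; first exact/aH.
    exact/(formA' L (sA' L Ls)).2.
  by apply: contraNneq vM => vM0; apply/(formA' M (sA' M Ms)).2.
have nd := not_dvdm_defining_poly arrA' formA' dH (formA H HA) HA'.
have thA' := thA; rewrite defining_polyU // in thA'.
have [r0 D0r] := D0_deletion hH a0 q0 Eq n0 (natK _) nd th0 thA' thh.
split=> //; split=> // e /lower re.
by rewrite leq_subLR add1n.
Qed.
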